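(* Let $p$ be a prime, $R=\mathrm{GR}(p^t,s)$ and $G=R\times R$ (additive group), and let $\Delta:G\to\widehat G$ be the isomorphism $(a,b)\mapsto\chi_{a,b}$, where $\chi_{a,b}((x,y))=\zeta_{p^t}^{\mathrm{Tr}(ax+by)}$. Let $S$ be a generalized relative difference set in $G$ relative to $\{R_i\times(p^i)\mid 0\le i\le t\}$. Then, for $T\subseteq G$, $S$ and $T$ form a primitive formally dual pair in $G$ (under $\Delta$) if and only if $T$ is a generalized relative difference set in $G$ relative to $\{(p^i)\times R_i\mid 0\le i\le t\}$. Moreover, $T$ can be chosen as $T=\{(x,y)\in G\mid (y,x)\in S\}$.
   Context: $\mathrm{GR}(p^t,s)=\mathbb{Z}_{p^t}[x]/(f(x))$ where $f$ is monic of degree $s$ with irreducible reduction mod $p$. Write $(p^i)=p^iR$, $R_i=(p^i)\setminus(p^{i+1})$ for $0\le i\le t-1$, $R_t=\{0\}$, and $v_p(a)=i$ iff $a\in R_i$. The Teichmüller set $\mathcal T$ is $\{0\}$ together with the unique cyclic subgroup of order $p^s-1$ of the unit group; every $x\in R$ is uniquely $\sum_{i=0}^{t-1}p^ix_i$ with $x_i\in\mathcal T$; $\sigma(\sum p^ix_i)=\sum p^ix_i^p$ and $\mathrm{Tr}(x)=\sum_{i=0}^{s-1}\sigma^i(x)$; $\zeta_{p^t}$ is a primitive $p^t$-th root of unity. For $A\subseteq G$, $\nu_A(g)=|\{(a_1,a_2)\in A\times A\mid g=a_1-a_2\}|$ and $\chi(A)=\sum_{x\in A}\chi(x)$. $S$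 is a GRDS relative to $\{R_i\times(p^i)\}$ if $\nu_S((a,b))=p^{v_p(a)s}$ when $v_p(a)\le v_p(b)$ and $0$ otherwise; $T$ is a GRDS relative to $\{(p^i)\times R_i\}$ if $\nu_T((a,b))=p^{v_p(b)s}$ when $v_p(a)\ge v_p(b)$ and $0$ otherwise. Subsets $S,T\subseteq G$ form a formally dual pair under $\Delta$ ($y\mapsto\chi_y$) if for all $y\in G$: $|\chi_y(S)|^2=\frac{|S|^2}{|T|}\nu_T(y)$ and $|\chi_y(T)|^2=\frac{|T|^2}{|S|}\nu_S(y)$. A subset is primitive if it is not contained in a coset of a proper subgroup and is not a union of cosets of a nontrivial subgroup; the pair is primitive if both sets are primitive. *)

(* Defs.v *)
From HB Require Import structures.
From mathcomp Require Import all_boot all_order all_algebra.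

Set Implicit Arguments.
Unset Strict Implicit.
Unset Printing Implicit Defensive.

Import Order.TTheory GRing.Theory Num.Theory.
Local Open Scope ring_scope.

HB.instance Definition _ (A B : finZmodType) := GRing.Zmodule.on (A * B)%type.

Section FormalDuality.
Variable V : finZmodType.
Implicit Types (A S T : {set V}) (y : V).

Definition nu A (g : V) : nat :=
  #|[set u : V * V | [&& u.1 \in A, u.2 \in A & g == u.1 - u.2]]|.

Definition add_subgroup (H : {set V}) : Prop := zmod_closed H.

Definition add_coset (H : {set V}) (x : V) : {set V} := [set x + h | h in H].

Definition primitive_set A : Prop :=
  (forall (H : {set V}) (x : V),
     add_subgroup H -> H != [set: V] -> ~~ (A \subset add_coset H x)) /\
  (forall H : {set V}, add_subgroup H -> H != [set 0] ->
     ~ exists B : {set V}, A = \bigcup_(x in B) add_coset H x).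

Variable C : numClosedFieldType.

Definition char_sum (chi : V -> C) A : C := \sum_(x in A) chi x.

(* Delta y is the character chi_y. *)
Definition formally_dual (Delta : V -> V -> C) S T : Prop :=
  forall y : V,
    `|char_sum (Delta y) S| ^+ 2 = #|S|%:R ^+ 2 / #|T|%:R * (nu T y)%:R /\
    `|char_sum (Delta y) T| ^+ 2 = #|T|%:R ^+ 2 / #|S|%:R * (nu S y)%:R.

Definition primitive_formally_dual (Delta : V -> V -> C) S T : Prop :=
  [/\ formally_dual Delta S T, primitive_set S & primitive_set T].

End FormalDuality.

(* For a = 0 the valuation is t, since layer t = {0}. *)
Section Valuation.
Variables (R : finComNzRingType) (p t s : nat).

Definition pideal (i : nat) : {set R} := [set p%:R ^+ i * x | x in [set: R]].

Definition layer (i : nat) : {set R} :=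
  if (i < t)%N then pideal i :\: pideal i.+1 else [set 0].

Definition vp (a : R) : nat :=
  if [pick i : 'I_t.+1 | a \in layer i] is Some i then val i else 0%N.

(* An element of multiplicative order p^s - 1 is a generator of the unique
   cyclic subgroup of that order in the unit group of R. *)
Definition teichmuller : {set R} :=
  0 |: [set x : R | [exists g : R, (p ^ s - 1)%N.-primitive_root g &&
                      [exists k : 'I_(p ^ s - 1), x == g ^+ k]]].

Definition teich_digits (x : R) : {ffun 'I_t -> R} :=
  odflt [ffun=> 0]
    [pick d : {ffun 'I_t -> R} | [forall i, d i \in teichmuller] &&
                                 (x == \sum_(i < t) p%:R ^+ i * d i)].

Definition sigma (x : R) : R :=
  \sum_(i < t) p%:R ^+ i * teich_digits x i ^+ p.

Definition trace (x : R) : R := \sum_(i < s) iter i sigma x.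

(* Relative to { R_i x (p^i) | 0 <= i <= t }. *)
Definition grds_layer_ideal (S : {set R * R}) : Prop :=
  forall a b : R,
    nu S (a, b) = if (vp a <= vp b)%N then (p ^ (vp a * s))%N else 0%N.

(* Relative to { (p^i) x R_i | 0 <= i <= t }. *)
Definition grds_ideal_layer (T : {set R * R}) : Prop :=
  forall a b : R,
    nu T (a, b) = if (vp b <= vp a)%N then (p ^ (vp b * s))%N else 0%N.

End Valuation.

Definition galois_poly (p t s : nat) (f : {poly 'Z_(p ^ t)}) : Prop :=
  [/\ f \is monic, size f = s.+1
    & irreducible_poly (map_poly (fun a : 'Z_(p ^ t) => (val a)%:R : 'F_p) f)].

Definition galois_ring (p t : nat) (f : {poly 'Z_(p ^ t)}) : Type := {poly %/ f}.

HB.instance Definition _ p t f := Finite.on (@galois_ring p t f).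
HB.instance Definition _ p t f := GRing.ComNzRing.on (@galois_ring p t f).

(* In GR(p^t, s), Tr x is the class of a constant polynomial, i.e. an element of
   Z/p^t; its 0th coefficient is the exponent of zeta. *)
Definition gr_char (p t s : nat) (f : {poly 'Z_(p ^ t)})
    (C : numClosedFieldType) (zeta : C)
    (ab xy : galois_ring f * galois_ring f) : C :=
  let tr : {poly %/ f} := trace p t s (ab.1 * xy.1 + ab.2 * xy.2) in
  zeta ^+ val (val tr)`_0.

(* Main.v *)
Require Import Defs.
From HB Require Import structures.
From mathcomp Require Import all_boot all_order all_algebra.
From mathcomp Require Import all_solvable all_field ring.

Set Implicit Arguments.
Unset Strict Implicit.
Unset Printing Implicit Defensive.

Import Order.TTheory GRing.Theory Num.Theory.
Local Open Scope ring_scope.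

(* Write q = p^s and N(a, b) = q^(v_p a) if v_p a <= v_p b, and 0 otherwise.  The
   hypothesis on S is nu_S = N, and since |chi(S)|^2 is the Fourier transform of
   nu_S, everything rests on the fact that the Fourier transform of N is q^t times
   N with its two arguments swapped.  Conversely, formal duality forces
   nu_T = |T| q^-t N(b, a), and summing over G gives |T| = q^t.

   That x |-> zeta^(Tr x) is a primitive additive character is the other half: a
   Hensel root of f above x^p yields a ring endomorphism lifting Frobenius, which
   agrees with sigma because both raise Teichmueller elements to the power p.  So
   Tr is additive, and it is nonzero mod p since it reduces to a polynomial of
   degree p^(s-1) < q.  *)

(** * Difference counts and characters *)

Section DifferenceCounts.
Variable V : finZmodType.
Implicit Types (A H : {set V}) (g : V).

Lemma nu0 A : nu A 0 = #|A|.
Proof.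
have d_inj : injective (fun x : V => (x, x)) by move=> x y [].
rewrite -(card_imset _ d_inj); apply: eq_card => -[x y]; rewrite inE /=.
apply/and3P/imsetP => [[xA _ /eqP/esym/subr0_eq <-]|[z zA [-> ->]]].
  by exists x.
by rewrite subrr.
Qed.

Lemma sum_nu A : (\sum_g nu A g = #|A| ^ 2)%N.
Proof.
rewrite -mulnn -cardsX -sum1_card (partition_big (fun u => u.1 - u.2) xpredT) //.
apply: eq_bigr => g _; rewrite /nu -sum1_card; apply: eq_bigl => -[x y].
by rewrite !inE /= andbA (eq_sym g).
Qed.

Lemma nu_coset A H x g :
  add_subgroup H -> A \subset add_coset H x -> (0 < nu A g)%N -> g \in H.
Proof.
move=> [_ HB] /subsetP AH /card_gt0P[[u v]]; rewrite inE /= => /and3P[uA vA /eqP->].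
have [/imsetP[h hH ->] /imsetP[k kH ->]] := (AH u uA, AH v vA).
by rewrite opprD addrACA subrr add0r HB.
Qed.

(** Translation by [g] maps [A] into itself, so each [x] in [A] gives the pair [(g + x, x)]. Hence
    every period has the maximal count. *)
Lemma nu_periodic A H g : add_subgroup H -> g \in H ->
  (exists B : {set V}, A = \bigcup_(x in B) add_coset H x) -> nu A g = #|A|.
Proof.
move=> [H0 HB] gH [B defA].
have HD h k : h \in H -> k \in H -> h + k \in H.
  by move=> hH kH; rewrite -[k]opprK HB // -sub0r HB.
have gA x : x \in A -> g + x \in A.
  rewrite defA => /bigcupP[b bB /imsetP[h hH ->]]; apply/bigcupP; exists b => //.
  by apply/imsetP; exists (g + h); rewrite ?HD // addrCA.
have d_inj : injective (fun x : V => (g + x, x)) by move=> x y [].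
rewrite -(card_imset _ d_inj); apply: eq_card => -[x y]; rewrite inE /=.
apply/and3P/imsetP => [[xA yA /eqP->]|[z zA [-> ->]]].
  by exists y; rewrite ?subrK.
by rewrite addrK gA.
Qed.

Variable C : numClosedFieldType.

(** Expand the sum times its conjugate and group the pairs by their difference. *)
Lemma normC_char_sum (chi : V -> C) A :
    (forall x y, chi (x - y) = chi x * (chi y)^*) ->
  `|char_sum chi A| ^+ 2 = \sum_g (nu A g)%:R * chi g.
Proof.
move=> chiB; rewrite normCK /char_sum rmorph_sum big_distrlr /=.
rewrite pair_big_dep (partition_big (fun u => u.1 - u.2) xpredT) //=.
apply: eq_bigr => g _.
rewrite (eq_bigr (fun=> chi g)) => [|u /andP[_ /eqP <-]]; last by rewrite chiB.
rewrite sumr_const mulr_natl; congr (_ *+ _); apply: eq_card => -[x y].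
by rewrite !inE unfold_in /= andbA (eq_sym g).
Qed.

End DifferenceCounts.
(** First-order Taylor expansion. It serves both the [p]-th power congruence and the Newton step of
    Hensel lifting. *)
Lemma horner_addr (R : comNzRingType) (P : {poly R}) a b :
  exists c, P.[a + b] = P.[a] + P^`().[a] * b + b ^+ 2 * c.
Proof.
elim/poly_ind: P => [|P d [c IHP]]; first by exists 0; rewrite deriv0 !horner0; ring.
exists (P^`().[a] + c * (a + b)).
by rewrite derivD derivM derivX derivC !hornerE IHP; ring.
Qed.

(** * Finite chain rings with residue field F = R / pR *)

Section ChainRing.
Variables (R : finComNzRingType) (F : finFieldType) (p t q : nat).
Variable pi : {rmorphism R -> F}.
Hypothesis t_gt0 : (0 < t)%N.
Hypothesis cardF : #|F| = q.
Hypothesis cardR : #|R| = (q ^ t)%N.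
Hypothesis pt0 : p%:R ^+ t = 0 :> R.
Hypothesis pi_surj : forall y, exists x, pi x = y.
Hypothesis pi_ker : forall x, pi x = 0 -> exists y, x = p%:R * y.

Local Notation "p^[ i ]" := (p%:R ^+ i : R).
Local Notation pid := (pideal R p).
Local Notation v := (@vp R p t).

Lemma card_residue_gt1 : (1 < q)%N.
Proof. by rewrite -cardF; apply: card_finNzRing_gt1. Qed.

Lemma residue_p : p%:R = 0 :> F.
Proof.
by apply/eqP; have /eqP := congr1 pi pt0;
by rewrite rmorphXn rmorph_nat rmorph0 expf_eq0 => /andP[].
Qed.

Lemma pow_eq0 i : (t <= i)%N -> p^[i] = 0.
Proof. by move=> le_ti; rewrite -(subnKC le_ti) exprD pt0 mul0r. Qed.

Lemma pidealP i x : reflect (exists y, x = p^[i] * y) (x \in pid i).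
Proof.
by apply: (iffP imsetP) => [[y _ ->]|[y ->]]; exists y; rewrite ?inE.
Qed.

Lemma pideal0 i : 0 \in pid i.
Proof. by apply/pidealP; exists 0; rewrite mulr0. Qed.

Lemma pideal_top i : (t <= i)%N -> pid i = [set 0].
Proof.
move=> le_ti; apply/setP=> x; rewrite inE; apply/pidealP/eqP => [[y ->]|->].
  by rewrite pow_eq0 ?mul0r.
by exists 0; rewrite mulr0.
Qed.

(** In [p^[i] * y], replace [y] by a chosen lift of its residue; the error lies in the next ideal.
    So a map from [F] times that ideal covers [pid i]. *)
Lemma card_pideal_step i : (#|pid i| <= q * #|pid i.+1|)%N.
Proof.
pose lft y := odflt 0 [pick x | pi x == y].
have lftK y : pi (lft y) = y.
  rewrite /lft; case: pickP => [x /eqP //|no_x].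
  by have [x /eqP] := pi_surj y; rewrite no_x.
rewrite -cardF -[#|F|]cardsT -cardsX.
apply: leq_trans (leq_imset_card (fun u => p^[i] * lft u.1 + u.2) _).
apply: subset_leq_card; apply/subsetP => x /pidealP[y ->].
have /pi_ker[z yz] : pi (y - lft (pi y)) = 0 by rewrite rmorphB lftK subrr.
apply/imsetP; exists (pi y, p^[i.+1] * z) => /=.
  by rewrite !inE; apply/pidealP; exists z.
by rewrite exprSr -mulrA -yz -mulrDr addrC subrK.
Qed.

(** Each step of the chain shrinks the ideal by a factor of at most [q]. Going down from [#|R|]
    gives a lower bound, going up from the zero ideal an upper bound, and the two coincide. *)
Lemma card_pideal i : (i <= t)%N -> #|pid i| = (q ^ (t - i))%N.
Proof.
have low k : (#|R| <= q ^ k * #|pid k|)%N.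
  elim: k => [|k IHk].
    rewrite mul1n -cardsT subset_leq_card //; apply/subsetP => x _.
    by apply/pidealP; exists x; rewrite mul1r.
  by rewrite (leq_trans IHk) // expnSr -mulnA leq_mul2l card_pideal_step orbT.
have up k : (k <= t)%N -> (#|pid (t - k)| <= q ^ k)%N.
  elim: k => [|k IHk] lt_kt; first by rewrite subn0 pideal_top // cards1.
  rewrite (leq_trans (card_pideal_step _)) // -subSn // subSS expnS.
  by rewrite leq_mul2l IHk ?orbT // ltnW.
move=> le_it; apply/eqP; rewrite eqn_leq -{1}(subKn le_it) up ?leq_subr //=.
have := low i; rewrite cardR -{1}(subnKC le_it) expnD leq_pmul2l //.
by rewrite expn_gt0 ltnW // card_residue_gt1.
Qed.

Lemma residue_unit u : pi u != 0 -> exists w, u * w = 1.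
Proof.
move=> u0; have [w pw] := pi_surj (pi u)^-1.
have /pi_ker[y uy] : pi (1 - u * w) = 0.
  by rewrite rmorphB rmorph1 rmorphM pw mulfV // subrr.
(* Geometric series: [u * w] is [1] minus the nilpotent element [p * y]. *)
exists (w * \sum_(i < t) (p%:R * y) ^+ i).
rewrite mulrA -(subKr 1 (u * w)) uy -opprB mulNr -subrX1.
by rewrite exprMn pt0 mul0r sub0r opprK.
Qed.

(** Keep dividing by [p] while the residue vanishes; reaching [t] divisions would force [a = 0]. *)
Lemma pow_factor a : a != 0 ->
  exists j u, [/\ (j < t)%N, a = p^[j] * u & pi u != 0].
Proof.
move=> a0; suff /(_ t (leqnn t))[[y]|//] : forall k, (k <= t)%N ->
    (exists y, a = p^[k] * y) \/
    exists j u, [/\ (j < t)%N, a = p^[j] * u & pi u != 0].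
  by rewrite pt0 mul0r => a0'; rewrite a0' eqxx in a0.
elim=> [|k IHk] lt_kt; first by left; exists a; rewrite mul1r.
have [[y def_a]|] := IHk (ltnW lt_kt); last by right.
have [/pi_ker[z def_y]|y0] := eqVneq (pi y) 0; last by right; exists k, y.
by left; exists z; rewrite exprSr -mulrA -def_y.
Qed.

Lemma pow_eq0E i : (p^[i] == 0) = (t <= i)%N.
Proof.
apply/eqP/idP => [pi0|]; last exact: pow_eq0.
rewrite leqNgt; apply/negP => lt_it.
have : (#|pid i| <= 1)%N.
  rewrite -(cards1 (0 : R)) subset_leq_card //; apply/subsetP => x /pidealP[y ->].
  by rewrite pi0 mul0r inE.
rewrite (card_pideal (ltnW lt_it)) leqNgt => /negP[].
by rewrite -{1}(expn0 q) ltn_exp2l ?card_residue_gt1 // subn_gt0.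
Qed.

Lemma mem_pideal_pow j u k : (j < t)%N -> pi u != 0 -> (k <= t)%N ->
  (p^[j] * u \in pid k) = (k <= j)%N.
Proof.
move=> lt_jt u0 le_kt; have [w uw] := residue_unit u0.
(* Multiplying by [p^[t.-1 - j]] and then by [w] turns the left side into [p^[t.-1]], which is
   nonzero. If [j < k], the right side acquires at least [t] factors of [p] and vanishes. *)
apply/pidealP/idP => [[y /(congr1 ( *%R p^[t.-1 - j]))]|le_kj]; last first.
  by exists (p^[j - k] * u); rewrite mulrA -exprD subnKC.
have le_jt : (j <= t.-1)%N by rewrite -ltnS prednK.
rewrite !mulrA -!exprD subnK // => /(congr1 ( *%R^~ w)).
rewrite -!mulrA uw mulr1; apply: contra_eqT; rewrite -ltnNge => lt_jk.
rewrite [X in _ != X * _]pow_eq0 ?mul0r ?pow_eq0E -?ltnNge ?prednK //.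
by rewrite -(prednK t_gt0) -{1}(subnK le_jt) -addnS leq_add2l.
Qed.

Lemma vp_pow j u : (j < t)%N -> pi u != 0 -> v (p^[j] * u) = j.
Proof.
move=> lt_jt u0.
have lay (i : 'I_t.+1) : (p^[j] * u \in layer R p t i) = (i == j :> nat).
  rewrite /layer; case: ltnP => [lt_it|le_ti].
    by rewrite inE !mem_pideal_pow // ?(ltnW lt_it) // -leqNgt -eqn_leq eq_sym.
  (* The exceptional layer [[set 0]] is rewritten as [pid t], so that the same membership criterion
     applies. *)
  rewrite -(pideal_top (leqnn t)) mem_pideal_pow // leqNgt lt_jt.
  by apply/esym/eqP => eq_ij; rewrite eq_ij leqNgt lt_jt in le_ti.
rewrite /vp; case: pickP => [i|/(_ (inord j))]; rewrite lay; first by move/eqP.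
by rewrite inordK ?eqxx // ltnW.
Qed.

Lemma vp0 : v 0 = t.
Proof.
rewrite /vp; case: pickP => [i|/(_ ord_max)]; last by rewrite /layer ltnn inE eqxx.
rewrite /layer; case: ltnP => [_|le_ti _]; first by rewrite inE !pideal0.
by apply/eqP; rewrite eqn_leq le_ti -ltnS ltn_ord.
Qed.

Lemma vp_le a : (v a <= t)%N.
Proof.
have [->|/pow_factor[j [u [lt_jt -> u0]]]] := eqVneq a 0; first by rewrite vp0.
by rewrite vp_pow // ltnW.
Qed.

Lemma mem_pideal a k : (k <= t)%N -> (a \in pid k) = (k <= v a)%N.
Proof.
move=> le_kt; have [->|/pow_factor[j [u [lt_jt -> u0]]]] := eqVneq a 0.
  by rewrite pideal0 vp0.
by rewrite vp_pow // mem_pideal_pow.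
Qed.

Lemma vp_eq_top a : (v a == t) = (a == 0).
Proof. by rewrite eqn_leq vp_le -mem_pideal // pideal_top // inE. Qed.

Lemma vp1 : v 1 = 0%N.
Proof. by rewrite -[1]mulr1 -[X in X * _](expr0 p%:R) vp_pow ?rmorph1 ?oner_eq0. Qed.

(** * Teichmueller elements and the trace *)

Hypothesis p_pr : prime p.
Variable s : nat.
Hypothesis def_q : q = (p ^ s)%N.

Lemma residue_pchar : p \in [pchar F].
Proof. by rewrite inE p_pr residue_p eqxx. Qed.

Lemma q_gt0 : (0 < q)%N.
Proof. exact: ltnW card_residue_gt1. Qed.

Lemma s_gt0 : (0 < s)%N.
Proof. by have := card_residue_gt1; rewrite def_q; case: s. Qed.

(** Each [p]-th power gains a factor of [p]: the linear Taylor term carries [p] from the derivative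
    of ['X^p], and the quadratic one carries [p^[k.+1]] twice. *)
Lemma expr_residue x y k : pi x = pi y ->
  exists z, x ^+ (p ^ k) = y ^+ (p ^ k) + p^[k.+1] * z.
Proof.
move=> eq_xy; elim: k => [|k [z IHk]].
  have /pi_ker[z xy] : pi (x - y) = 0 by rewrite rmorphB eq_xy subrr.
  by exists z; rewrite !expr1 -xy addrC subrK.
have [c] := horner_addr 'X^p (y ^+ (p ^ k)) (p^[k.+1] * z).
rewrite -IHk derivXn hornerMn !hornerXn -!exprM -!expnSr => ->.
exists (y ^+ (p ^ k * p.-1) * z + p^[k] * z ^+ 2 * c).
by rewrite -mulr_natl !exprS; ring.
Qed.

Lemma expr_residue_eq x y : pi x = pi y -> x ^+ (q ^ t) = y ^+ (q ^ t).
Proof.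
move=> /expr_residue eq_xy; rewrite def_q -expnM.
have [z ->] := eq_xy (s * t)%N.
by rewrite pow_eq0 ?mul0r ?addr0 // leqW // leq_pmull // s_gt0.
Qed.

Lemma expr_q_iter (B : pzRingType) (x : B) k : x ^+ q = x -> x ^+ (q ^ k) = x.
Proof. by move=> xq; elim: k => [|k IHk]; rewrite ?expr1 // expnSr exprM IHk. Qed.

(** A fixed point of [x ^+ q] is its own [q ^ t]-th power, and that power depends only on the
    residue. *)
Lemma fixed_inj x y : x ^+ q = x -> y ^+ q = y -> pi x = pi y -> x = y.
Proof.
by move=> xq yq /expr_residue_eq; rewrite !(expr_q_iter t).
Qed.

Lemma residue_expr_q x : pi x ^+ q = pi x.
Proof. by rewrite -cardF expf_card. Qed.

(** The power [x ^+ (q ^ t)] is the Teichmueller representative of the residue class of [x]. *)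
Lemma fixed_lift x : let y := x ^+ (q ^ t) in y ^+ q = y /\ pi y = pi x.
Proof.
split; last by rewrite rmorphXn (expr_q_iter t) ?residue_expr_q.
by rewrite exprAC; apply: expr_residue_eq; rewrite rmorphXn residue_expr_q.
Qed.

Lemma residue_prim_root : exists w : F, (q - 1).-primitive_root w.
Proof.
have q1 : (0 < q - 1)%N by rewrite subn_gt0 card_residue_gt1.
have unity : all (q - 1).-unity_root (enum (predC1 (0 : F))).
  apply/allP => x; rewrite mem_enum unity_rootE => x0.
  apply/eqP/(mulfI x0); rewrite mulr1 -exprS subn1 prednK ?q_gt0 //.
  by rewrite -cardF expf_card.
have enough : (q - 1 <= size (enum (predC1 (0%R : F))))%N.
  by rewrite -cardE cardC1 cardF subn1.
by have /hasP[w _ wP] := has_prim_root q1 unity (enum_uniq _) enough; exists w.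
Qed.

(** This trades the description by a generator for an equation, on which ring morphisms and
    [fixed_inj] act directly. *)
Lemma teichmullerE x : (x \in teichmuller R p s) = (x ^+ q == x).
Proof.
have expq (B : pzRingType) (y : B) : y ^+ q = y * y ^+ (q - 1).
  by rewrite -exprS subn1 prednK ?q_gt0.
rewrite !inE -def_q; apply/orP/eqP => [[/eqP->|]|xq].
- by rewrite expr0n eqn0Ngt q_gt0.
- case/existsP=> g /andP[/prim_expr_order g1 /existsP[k /eqP->]].
  by rewrite exprAC expq g1 mulr1.
have [pix0|pix0] := eqVneq (pi x) 0; [left|right].
  by apply/eqP/fixed_inj; rewrite ?expr0n ?(eqn0Ngt q) ?q_gt0 ?rmorph0.
have [w wP] := residue_prim_root; have [u def_w] := pi_surj w.
(* The generator is the Teichmueller lift of a primitive root [w] of [F]; it has the same order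
   because fixed points are determined by their residues. *)
have [] := fixed_lift u; set g := u ^+ _ => gq pig.
have gXq n : (g ^+ n) ^+ q = g ^+ n by rewrite exprAC gq.
have gE n : (g ^+ n == 1) = (w ^+ n == 1).
  rewrite -def_w -pig -rmorphXn -(rmorph1 pi).
  by apply/eqP/eqP => [->//|/fixed_inj->]; rewrite ?expr1n.
apply/existsP; exists g; apply/andP; split.
  case/andP: (wP) => q1_gt0 /forallP wP'; apply/andP; split=> //.
  apply/forallP => i; move: (wP' i); rewrite !unity_rootE gE.
  by [].
have : pi x ^+ (q - 1) = 1.
  by apply: (mulfI pix0); rewrite mulr1 -expq residue_expr_q.
case/(prim_rootP wP) => k pix; apply/existsP; exists k; apply/eqP/fixed_inj => //.
by rewrite rmorphXn pig def_w.
Qed.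

(** Digits are peeled off one at a time: subtract the Teichmueller representative of the current
    quotient, then divide the difference by [p]. *)
Lemma teich_digits_exist x : exists d : {ffun 'I_t -> R},
  (forall i, d i \in teichmuller R p s) /\ x = \sum_(i < t) p^[i] * d i.
Proof.
suff /(_ t)[d [y [dT ->]]] : forall n, exists (d : nat -> R) y,
    (forall i, d i \in teichmuller R p s) /\
    x = \sum_(i < n) p^[i] * d i + p^[n] * y.
  exists [ffun i : 'I_t => d i]; split=> [i|]; first by rewrite ffunE.
  by rewrite pt0 mul0r addr0; apply: eq_bigr => i _; rewrite ffunE.
elim=> [|n [d [y [dT ->]]]].
  exists (fun=> 0), x; split=> [i|]; last by rewrite big_ord0 add0r mul1r.
  by rewrite !inE eqxx.
have [] := fixed_lift y; set z := y ^+ _ => zq piz.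
have /pi_ker[y' yz] : pi (y - z) = 0 by rewrite rmorphB piz subrr.
exists (fun i => if i == n then z else d i), y'; split=> [i|].
  by case: eqP => _; rewrite ?dT // teichmullerE zq.
rewrite big_ord_recr /= eqxx -addrA exprSr -mulrA -yz -mulrDr (addrC z) subrK.
by congr (_ + _); apply: eq_bigr => i _; rewrite (ltn_eqF (ltn_ord i)).
Qed.

Variable phi : {rmorphism R -> R}.
Hypothesis pi_phi : forall x, pi (phi x) = pi x ^+ p.

(** For a digit [d], both [phi d] and [d ^+ p] are fixed by the [q]-th power and have the same
    residue, so they agree, whichever expansion the choice returned. *)
Lemma sigmaE x : sigma p t s x = phi x.
Proof.
rewrite /sigma /teich_digits; case: pickP => [d /andP[/forallP dT /eqP ->]|no_d].
  rewrite rmorph_sum; apply: eq_bigr => i _ /=.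
  rewrite rmorphM rmorphXn rmorph_nat; congr (_ * _).
  have /eqP dq : d i ^+ q == d i by rewrite -teichmullerE.
  by apply: fixed_inj; rewrite ?pi_phi -?rmorphXn ?dq // exprAC dq.
have [d [dT def_x]] := teich_digits_exist x.
by have := no_d d; rewrite {1}def_x eqxx andbT => /forallP[].
Qed.

Local Notation Tr := (@trace R p t s).

Lemma traceE x : Tr x = \sum_(i < s) iter i phi x.
Proof. by apply: eq_bigr => i _; apply: eq_iter => y; rewrite sigmaE. Qed.

Lemma traceD x y : Tr (x + y) = Tr x + Tr y.
Proof.
rewrite !traceE -big_split /=; apply: eq_bigr => i _.
by elim: (nat_of_ord i) => //= n ->; rewrite rmorphD.
Qed.

Lemma traceMn x n : Tr (x *+ n) = Tr x *+ n.
Proof.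
rewrite !traceE -sumrMnl; apply: eq_bigr => i _.
by elim: (nat_of_ord i) => //= m ->; rewrite rmorphMn.
Qed.

Lemma residue_trace x : pi (Tr x) = \sum_(i < s) pi x ^+ (p ^ i).
Proof.
rewrite traceE rmorph_sum; apply: eq_bigr => i _ /=.
by elim: (nat_of_ord i) => [|n IHn] /=; rewrite ?expr1 // pi_phi IHn expnSr exprM.
Qed.

(** Frobenius shifts the terms of the trace cyclically, the last one returning to the first since
    [pi x ^+ q = pi x]. *)
Lemma residue_trace_fixed x : pi (Tr x) ^+ p = pi (Tr x).
Proof.
rewrite residue_trace -(pFrobenius_autE residue_pchar) rmorph_sum /=.
have [n def_s] : exists n, s = n.+1 by exists s.-1; rewrite prednK ?s_gt0.
have /eqP := residue_expr_q x; rewrite def_q def_s -subr_eq0.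
rewrite [in X in _ -> _ = X]big_ord_recl big_ord_recr /= expr1 addrC => /eqP xq.
rewrite pFrobenius_autE -exprM -expnSr -[X in X + _](subrK (pi x)) xq add0r.
by congr (_ + _); apply: eq_bigr => i _; rewrite pFrobenius_autE -exprM -expnSr.
Qed.

Lemma residue_trace_neq0 : exists x, pi (Tr x) != 0.
Proof.
pose P : {poly F} := \sum_(i < s) 'X^(p ^ i).
have P_s i : (i < s)%N -> P`_(p ^ i) = 1.
  move=> lt_is; rewrite coef_sum (bigD1 (Ordinal lt_is)) //= coefXn eqxx.
  rewrite big1 ?addr0 // => j; rewrite -val_eqE /= coefXn eqn_exp2l ?prime_gt1 //.
  by rewrite eq_sym => /negPf->.
have P0 : P != 0.
  by apply/eqP => P0; have /eqP := P_s 0%N s_gt0; rewrite P0 coef0 eq_sym oner_eq0.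
have szP : (size P <= q)%N.
  apply: (leq_trans (size_sum _ _ _)); apply/bigmax_leqP => i _.
  by rewrite size_polyXn def_q ltn_exp2l ?prime_gt1.
have [/forallP Pr|/forallPn[y]] := boolP [forall y, root P y].
  have Pall : all (root P) (enum F) by apply/allP.
  by have := max_poly_roots P0 Pall (enum_uniq _); rewrite -cardE cardF ltnNge szP.
rewrite rootE /P horner_sum; have [x <-] := pi_surj y => Px; exists x.
rewrite residue_trace; apply: contra Px => /eqP tr0; rewrite -[X in _ == X]tr0.
by apply/eqP; apply: eq_bigr => i _; rewrite hornerXn.
Qed.

(** The polynomial ['X^p - 'X] already has the [p] distinct roots [0, ..., p - 1] and admits no
    further one. *)
Lemma fixed_prime_field (y : F) : y ^+ p = y -> exists c, y = c%:R.
Proof.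
move=> yp; pose rs : seq F := [seq c%:R | c <- iota 0 p].
have rs_uniq : uniq rs.
  rewrite map_inj_in_uniq ?iota_uniq // => c d; rewrite !mem_iota /= !add0n.
  wlog le_cd : c d / (c <= d)%N => [IH|] lt_c lt_d /eqP.
    by case/orP: (leq_total c d) => [/IH|/IH] H /eqP e; [apply: H | apply/esym/H].
  rewrite eq_sym -subr_eq0 -natrB // -(dvdn_pcharf residue_pchar).
  move=> p_dvd; apply/eqP; rewrite eqn_leq le_cd -subn_eq0 /=.
  apply: contraTT p_dvd; rewrite -lt0n => dc_gt0.
  by rewrite gtnNdvd // (leq_ltn_trans (leq_subr _ _)).
have [/mapP[c _ ->]|y_rs] := boolP (y \in rs); first by exists c.
have P0 : 'X^p - 'X != 0 :> {poly F}.
  by rewrite -size_poly_gt0 size_polyDl size_polyXn // size_polyN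
             size_polyX ltnS prime_gt1.
have Pall : all (root ('X^p - 'X)) (y :: rs).
  rewrite /= rootE !hornerE yp subrr eqxx; apply/allP => _ /mapP[c _ ->].
  by rewrite rootE !hornerE -(pFrobenius_autE residue_pchar) rmorph_nat subrr.
have := max_poly_roots P0 Pall; rewrite /= y_rs => /(_ rs_uniq).
rewrite size_polyDl size_polyXn ?size_polyN ?size_polyX ?ltnS ?prime_gt1 //.
by rewrite size_map size_iota ltnn.
Qed.

(** Multiplying by [p^[t.-1]] retains only the residue of [Tr z], which is a nonzero element of the
    prime field for a suitable [z]. *)
Lemma trace_primitive :
  exists z c, ~~ (p %| c)%N /\ Tr (p^[t.-1] * z) = (p ^ t.-1 * c)%:R.
Proof.
have [z z0] := residue_trace_neq0.
have [c zc] := fixed_prime_field (residue_trace_fixed z).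
exists z, c; split; first by rewrite (dvdn_pcharf residue_pchar) -zc.
have /pi_ker[y zy] : pi (Tr z - c%:R) = 0 by rewrite rmorphB zc rmorph_nat subrr.
rewrite -natrX mulr_natl traceMn -[Tr z *+ _]mulr_natl -[Tr z](subrK c%:R) zy.
by rewrite natrX mulrDr mulrA -exprSr prednK // pt0 mul0r add0r natrM natrX.
Qed.

(** * The Fourier transform of the layer counts *)

Definition layer_count a b : nat := if (v a <= v b)%N then (q ^ v a)%N else 0%N.

Lemma layer_count_gt0 a b : (0 < layer_count a b)%N = (v a <= v b)%N.
Proof.
by rewrite /layer_count; case: ifP => // _; rewrite expn_gt0 ltnW // card_residue_gt1.
Qed.

Lemma layer_count_top a b : layer_count a b = (q ^ t)%N -> (a, b) = 0.
Proof.
rewrite /layer_count; case: ifP => [le_ab /eqP|_ /esym/eqP]; last first.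
  by rewrite expn_eq0 eqn0Ngt ltnW // card_residue_gt1.
rewrite eqn_exp2l ?card_residue_gt1 // => /eqP va; move: le_ab.
rewrite va => le_tb; move/eqP: va; rewrite vp_eq_top => /eqP->.
have: v b == t by rewrite eqn_leq vp_le.
by rewrite vp_eq_top => /eqP->.
Qed.

Lemma layer_count00 : layer_count 0 0 = (q ^ t)%N.
Proof. by rewrite /layer_count leqnn vp0. Qed.

(** A period [g] would have count [#|S| = q ^ t], which is attained only at [0]. A coset containing
    [S] is a coset of everything, because the differences of [S] generate the group. *)
Lemma grds_primitive (S : {set R * R}) :
    (forall a b, nu S (a, b) = layer_count a b) \/
    (forall a b, nu S (a, b) = layer_count b a) ->
  primitive_set S.
Proof.
have v_ge0 x : (v x <= v 0%R)%N by rewrite vp0 vp_le.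
move=> nuS; have nuS0 : #|S| = (q ^ t)%N.
  by rewrite -nu0; case: nuS => ->; rewrite layer_count00.
split=> [H x sgH|H sgH]; last first.
  apply: contra_neq_not => perS; apply/setP => g; rewrite inE.
  apply/idP/eqP => [gH|->]; last by case: sgH.
  have := nu_periodic sgH gH perS; rewrite nuS0.
  by case: g {gH} => a b; case: nuS => -> /layer_count_top // -[-> ->].
apply: contra_neqN => sub_S; apply/setP => -[a b]; rewrite in_setT.
have inH := nu_coset sgH sub_S; case: (sgH) => H0 HB.
have HD h k : h \in H -> k \in H -> h + k \in H.
  by move=> hH kH; rewrite -[k]opprK HB // -sub0r HB.
case: nuS => nuS.
  (* All three terms lie in the support of [nu S]: [v 0 = t] is the largest valuation and [v 1 = 0]
     the smallest. *)
  have -> : (a, b) = (a, 0) + ((1, b) - (1, 0)).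
    by congr pair; rewrite /= ?subrr ?subr0 ?addr0 ?add0r.
  by rewrite HD ?HB ?inH ?nuS ?layer_count_gt0 ?vp1 ?v_ge0.
have -> : (a, b) = (0, b) + ((a, 1) - (0, 1)).
  by congr pair; rewrite /= ?subrr ?subr0 ?addr0 ?add0r.
by rewrite HD ?HB ?inH ?nuS ?layer_count_gt0 ?vp1 ?v_ge0.
Qed.

(** * Character sums over ideals and formal duality *)

Variables (C : numClosedFieldType) (psi : R -> C).
Hypothesis psi0 : psi 0 = 1.
Hypothesis psiD : forall x y, psi (x + y) = psi x * psi y.
Hypothesis psiN : forall x, psi (- x) = (psi x)^*.
Hypothesis psi_primitive : exists z, psi (p^[t.-1] * z) != 1.

(** Orthogonality: the character [psi (a * x)] is trivial on [pid i] exactly when [a] annihilates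
    that ideal. *)
Lemma sum_psi_pideal a i : (i <= t)%N ->
  \sum_(x in pid i) psi (a * x) = if (t - i <= v a)%N then (q ^ (t - i))%:R else 0.
Proof.
move=> le_it; case: ifPn => [le_a|lt_a].
  rewrite -card_pideal // -sumr_const; apply: eq_bigr => x /pidealP[y ->].
  move: le_a; rewrite -mem_pideal ?leq_subr // => /pidealP[z ->].
  by rewrite mulrACA -exprD subnK // pt0 mul0r.
have [x0 x0i psi_x0] : exists2 x, x \in pid i & psi (a * x) != 1.
  have [a0|/pow_factor[j [u [lt_jt def_a u0]]]] := eqVneq a 0.
    by rewrite a0 vp0 leq_subr in lt_a.
  have [[w uw] [z psi_z]] := (residue_unit u0, psi_primitive).
  move: lt_a; rewrite def_a vp_pow // -ltnNge ltn_subRL => lt_ij.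
  (* The point is chosen to make its product with [a] equal to [p^[t.-1] * z], where [psi] is
     nontrivial. *)
  exists (p^[i] * (p^[t.-1 - (i + j)] * (w * z))).
    by apply/pidealP; exists (p^[t.-1 - (i + j)] * (w * z)).
  suff -> : p^[j] * u * (p^[i] * (p^[t.-1 - (i + j)] * (w * z))) = p^[t.-1] * z by [].
  rewrite mulrACA [u * _]mulrCA [u * (w * z)]mulrA uw mul1r mulrA -!exprD.
  by rewrite (addnC j) subnKC // -ltnS prednK.
set Z := \sum_(x in _) _; apply/eqP.
(* Translation by [x0] permutes the ideal and multiplies the sum by a factor other than [1]. *)
have : Z = psi (a * x0) * Z.
  rewrite {1}/Z (reindex_inj (addrI x0)) /Z big_distrr /=.
  have shift x : (x0 + x \in pid i) = (x \in pid i).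
    move/pidealP: x0i => [y0 ->]; apply/pidealP/pidealP => -[y def_y].
      by exists (y - y0); rewrite mulrBr -def_y addrC addKr.
    by exists (y0 + y); rewrite mulrDr def_y.
  by apply: eq_big => x // _; rewrite mulrDr psiD.
move/eqP; rewrite -{1}[Z]mul1r -subr_eq0 -mulrBl mulf_eq0 subr_eq0 eq_sym.
by rewrite (negPf psi_x0).
Qed.

(* Summing over y first turns the layer weight q^(v x) into the constant q^t on the
   ideal (p^(t - v b)). *)
Lemma sum_layer_count a b :
  \sum_x \sum_y (layer_count x y)%:R * psi (a * x + b * y) =
  (q ^ t)%:R * (layer_count b a)%:R.
Proof.
have inner x : \sum_y (layer_count x y)%:R * psi (a * x + b * y) =
    if x \in pid (t - v b) then (q ^ t)%:R * psi (a * x) else 0.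
  transitivity ((q ^ v x)%:R * psi (a * x) * \sum_(y in pid (v x)) psi (b * y)).
    rewrite big_distrr [RHS]big_mkcond /=; apply: eq_bigr => y _.
    rewrite mem_pideal ?vp_le // /layer_count; case: ifP => _; last by rewrite mul0r.
    by rewrite psiD mulrA.
  rewrite sum_psi_pideal ?vp_le // mem_pideal ?leq_subr // leq_subLR addnC -leq_subLR.
  by case: ifP => _; rewrite ?mulr0 // mulrAC -natrM -expnD subnKC ?vp_le.
under eq_bigr do rewrite inner.
rewrite -big_mkcond -big_distrr /= sum_psi_pideal ?leq_subr // subKn ?vp_le //.
by rewrite /layer_count; case: ifP.
Qed.

Definition pair_char (ab xy : R * R) : C := psi (ab.1 * xy.1 + ab.2 * xy.2).

Lemma pair_charB ab x y : pair_char ab (x - y) = pair_char ab x * (pair_char ab y)^*.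
Proof. by rewrite /pair_char -psiN -psiD /= !mulrBr opprD addrACA. Qed.

Lemma normC_layer_ideal S a b : (forall a b, nu S (a, b) = layer_count a b) ->
  `|char_sum (pair_char (a, b)) S| ^+ 2 = (q ^ t)%:R * (layer_count b a)%:R.
Proof.
move=> nuS; rewrite (normC_char_sum _ (pair_charB (a, b))) -sum_layer_count pair_bigA.
by apply: eq_bigr => -[x y] _; rewrite nuS.
Qed.

Lemma normC_ideal_layer S a b : (forall a b, nu S (a, b) = layer_count b a) ->
  `|char_sum (pair_char (a, b)) S| ^+ 2 = (q ^ t)%:R * (layer_count a b)%:R.
Proof.
move=> nuS; rewrite (normC_char_sum _ (pair_charB (a, b))) -sum_layer_count.
rewrite exchange_big pair_bigA.
by apply: eq_bigr => -[x y] _; rewrite nuS /pair_char /= addrC.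
Qed.

Lemma grds_dual_iff (S T : {set R * R}) :
    (forall a b, nu S (a, b) = layer_count a b) ->
  primitive_formally_dual pair_char S T <->
  (forall a b, nu T (a, b) = layer_count b a).
Proof.
move=> nuS; have cardS : #|S| = (q ^ t)%N by rewrite -nu0 nuS layer_count00.
have qt0 : (q ^ t)%:R != 0 :> C.
  by rewrite pnatr_eq0 -lt0n expn_gt0 ltnW // card_residue_gt1.
split=> [[dual _ _] |nuT]; last first.
  have cardT : #|T| = (q ^ t)%N by rewrite -nu0 nuT layer_count00.
  split; [move=> [a b] | by apply: grds_primitive; left
         | by apply: grds_primitive; right].
  rewrite normC_layer_ideal // normC_ideal_layer // cardS cardT nuS nuT.
  by rewrite expr2 mulfK.
(* If [T] were empty, the inverse of [0] being [0] would make the right side of the first duality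
   equation vanish at the origin, where the left side is [q ^ t] squared. *)
have T0 : #|T|%:R != 0 :> C.
  apply: contra_eqN (dual (0, 0)).1 => /eqP->.
  rewrite normC_layer_ideal // layer_count00 invr0 mulr0 mul0r.
  by rewrite mulf_neq0.
have nuT a b : (q ^ t)%:R * (nu T (a, b))%:R = #|T|%:R * (layer_count b a)%:R :> C.
  apply: (mulfI qt0); have := (dual (a, b)).1; rewrite normC_layer_ideal // cardS.
  move/(congr1 ( *%R #|T|%:R)) => E; rewrite [RHS]mulrCA {}E.
  by rewrite [RHS]mulrA (mulrCA #|T|%:R) divff // mulr1 expr2 mulrA.
(* Summing [nuT] over the group gives [q ^ t * #|T| ^ 2 = #|T| * (q ^ t) ^ 2]. *)
have cardT : #|T| = (q ^ t)%N.
  have sumN : (\sum_a \sum_b layer_count b a = (q ^ t) ^ 2)%N.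
    rewrite exchange_big pair_bigA -cardS -sum_nu.
    by apply: eq_bigr => -[a b] _; rewrite nuS.
  have : \sum_a \sum_b (q ^ t)%:R * (nu T (a, b))%:R =
         \sum_a \sum_b #|T|%:R * (layer_count b a)%:R :> C.
    by apply: eq_bigr => a _; apply: eq_bigr => b _.
  under eq_bigr do rewrite -big_distrr -natr_sum /=.
  under [RHS]eq_bigr do rewrite -big_distrr -natr_sum /=.
  rewrite -!big_distrr -!natr_sum /= pair_bigA /= sumN.
  rewrite (eq_bigr (nu T)) => [|[]//]; rewrite sum_nu -!mulnn !natrM mulrCA.
  by move/(mulfI T0)/(mulfI qt0) => /eqP; rewrite eqr_nat => /eqP.
move=> a b; have := nuT a b; rewrite cardT => /(mulfI qt0)/eqP.
by rewrite eqr_nat => /eqP.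
Qed.

Lemma nu_swap (S : {set R * R}) a b :
  nu [set xy | (xy.2, xy.1) \in S] (a, b) = nu S (b, a).
Proof.
pose sw (x : R * R) := (x.2, x.1); have swK : involutive sw by case.
pose sw2 (u : (R * R) * (R * R)) := (sw u.1, sw u.2).
have sw2_inj : injective sw2 by apply: (can_inj (g := sw2)) => -[[? ?] [? ?]].
rewrite /nu -(card_imset _ sw2_inj); apply: eq_card => u.
rewrite -[u](_ : sw2 (sw2 u) = u) ?(mem_imset _ _ sw2_inj) //;
  last by case: u => -[? ?] [].
case: u => -[x1 y1] [x2 y2]; rewrite !inE /= /sw /=.
by rewrite !xpair_eqE [X in _ && (_ && X)]andbC.
Qed.

End ChainRing.

(** * Galois rings *)

(* The proofs are arguments of [zp_emb] and [qeval] so that their morphism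
   structures can be attached to the head symbols; [qeval] yields both the residue
   map (y = class of X in F) and the Frobenius lift (y = Hensel root in R). *)
Definition zp_emb (n : nat) (B : comNzRingType) of (1 < n)%N & n%:R = 0 :> B :=
  fun a : 'Z_n => (val a)%:R : B.

(** * Evaluation morphisms out of quotients of polynomial rings over ['Z_n] *)

Section ZpEmbedding.
Variables (n : nat) (B : comNzRingType) (n_gt1 : (1 < n)%N) (nB : n%:R = 0 :> B).
Local Notation e := (zp_emb n_gt1 nB).

Lemma zp_emb_nat m : e m%:R = m%:R.
Proof.
rewrite /zp_emb /= val_Zp_nat // [in RHS](divn_eq m n).
by rewrite natrD natrM nB mulr0 add0r.
Qed.

Lemma zp_emb_add a b : e (a + b) = e a + e b.
Proof. by rewrite -{1}[a]natr_Zp -{1}[b]natr_Zp -natrD zp_emb_nat natrD. Qed.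

Lemma zp_emb_is_zmod_morphism : zmod_morphism e.
Proof.
by move=> a b; have := zp_emb_add (a - b) b; rewrite subrK => ->; rewrite addrK.
Qed.

Lemma zp_emb_is_monoid_morphism : monoid_morphism e.
Proof.
split=> [|a b]; first exact: (zp_emb_nat 1).
by rewrite -{1}[a]natr_Zp -{1}[b]natr_Zp -natrM zp_emb_nat natrM.
Qed.

HB.instance Definition _ :=
  GRing.isZmodMorphism.Build 'Z_n B e zp_emb_is_zmod_morphism.
HB.instance Definition _ :=
  GRing.isMonoidMorphism.Build 'Z_n B e zp_emb_is_monoid_morphism.

(** The coefficients are images of integers, which every ring morphism preserves. *)
Lemma horner_zp_emb (D : comNzRingType) (h : {rmorphism B -> D}) (nD : n%:R = 0 :> D)
    (g : {poly 'Z_n}) y :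
  h (map_poly e g).[y] = (map_poly (zp_emb n_gt1 nD) g).[h y].
Proof.
rewrite -horner_map -map_poly_comp; congr (_.[_]).
by apply: eq_map_poly => a /=; rewrite /zp_emb rmorph_nat.
Qed.

Variable f : {poly 'Z_n}.

Definition qeval (y : B) of root (map_poly e f) y :=
  fun x : {poly %/ f} => (map_poly e (val x)).[y].

Section QuotientEvaluation.
Hypotheses (f_monic : f \is monic) (f_gt1 : (1 < size f)%N).
Variables (y : B) (fy : root (map_poly e f) y).

Lemma mk_monic_id : mk_monic f = f.
Proof. by rewrite /mk_monic f_gt1 f_monic. Qed.

(** A polynomial and its remainder differ by a multiple of [f], which vanishes at [y]. *)
Lemma qeval_in_qpoly g : qeval fy (in_qpoly f g) = (map_poly e g).[y].
Proof.
rewrite /qeval /= mk_monic_id.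
rewrite [in RHS](Pdiv.RingMonic.rdivp_eq f_monic g) rmorphD rmorphM.
rewrite hornerD hornerM.
by rewrite (rootP fy) mulr0 add0r.
Qed.

Lemma qeval_is_zmod_morphism : zmod_morphism (qeval fy).
Proof.
move=> a b; rewrite /qeval (_ : val (a - b) = val a - val b) //.
by rewrite rmorphB hornerD hornerN.
Qed.

Lemma qeval_is_monoid_morphism : monoid_morphism (qeval fy).
Proof.
split=> [|a b]; first by rewrite -(in_qpoly1 f) qeval_in_qpoly rmorph1 hornerC.
have -> : a * b = in_qpoly f (val a * val b) by [].
by rewrite qeval_in_qpoly rmorphM hornerM.
Qed.

Definition qeval_morph : {rmorphism {poly %/ f} -> B} :=
  HB.pack (qeval fy)
    (GRing.isZmodMorphism.Build {poly %/ f} B (qeval fy) qeval_is_zmod_morphism)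
    (GRing.isMonoidMorphism.Build {poly %/ f} B (qeval fy)
       qeval_is_monoid_morphism).

End QuotientEvaluation.
End ZpEmbedding.

Lemma in_qpoly_val (B : comNzRingType) (h : {poly B}) (x : {poly %/ h}) :
  in_qpoly h (val x) = x.
Proof. by apply/val_inj/in_qpoly_small/size_mk_monic. Qed.

(** * Galois rings and their residue fields *)

Section GaloisRing.
Variables (p t s : nat) (f : {poly 'Z_(p ^ t)}).
Hypotheses (p_pr : prime p) (t_gt0 : (0 < t)%N) (f_galois : galois_poly s f).

Local Notation n := (p ^ t)%N.
Local Notation R := (galois_ring f).

Lemma pt_gt1 : (1 < n)%N.
Proof. by rewrite -(expn0 p) ltn_exp2l ?prime_gt1. Qed.

Lemma pt_eq0 (B : comNzRingType) : p%:R = 0 :> B -> n%:R = 0 :> B.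
Proof. by move=> pB; rewrite natrX pB expr0n eqn0Ngt t_gt0. Qed.

Lemma Fp_p : p%:R = 0 :> 'F_p.
Proof. by apply/eqP; rewrite -(dvdn_pcharf (pchar_Fp p_pr)). Qed.

Local Notation e B pB := (zp_emb (B := B) pt_gt1 (pt_eq0 pB)).

Lemma zp_emb_Fp_ker (g : {poly 'Z_n}) : map_poly (e _ Fp_p) g = 0 ->
  exists k, g = p%:R * k.
Proof.
move=> g0; exists (\poly_(i < size g) (val g`_i %/ p)%:R).
apply/polyP => i; rewrite mulr_natl coefMn coef_poly.
case: ltnP => [_|/leq_sizeP->//]; last by rewrite mul0rn.
have /eqP : (map_poly (e _ Fp_p) g)`_i = 0 by rewrite g0 coef0.
rewrite coef_map /= /zp_emb -(dvdn_pcharf (pchar_Fp p_pr)) => p_gi.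
by rewrite -mulrnA divnK // natr_Zp.
Qed.

Lemma zp_emb_Fp_surj (g : {poly 'F_p}) : exists k, map_poly (e _ Fp_p) k = g.
Proof.
exists (\poly_(i < size g) (val g`_i)%:R); apply/polyP => i.
rewrite coef_map coef_poly; case: ltnP => [_|/leq_sizeP g_i].
  by rewrite /= zp_emb_nat natr_Zp.
by rewrite g_i ?rmorph0.
Qed.

(** Take [F] to be the prime field with a root [w] of the reduction of [f] adjoined. A polynomial of
    degree below [s] that vanishes at [w] has zero reduction, hence coefficients divisible by
    [p]. *)
Lemma residue_field_exists : exists (F : finFieldType) (pF : p%:R = 0 :> F) (w : F),
  [/\ #|F| = (p ^ s)%N, root (map_poly (e F pF) f) w,
      forall y, exists g, y = (map_poly (e F pF) g).[w]
    & forall g : {poly 'Z_n}, (size g <= s)%N -> (map_poly (e F pF) g).[w] = 0 ->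
        exists k, g = p%:R * k].
Proof.
have [f_mon f_sz f_irr] := f_galois; pose h := map_poly (e _ Fp_p) f.
have h_mon : h \is monic := monic_map _ f_mon.
have h_sz : size h = s.+1.
  by rewrite size_map_poly_id0 // (monicP f_mon) rmorph1 oner_eq0.
have hI : monic_irreducible_poly h := (f_irr, h_mon).
pose F : finFieldType := {poly %/ h with hI}.
pose q : {rmorphism {poly 'F_p} -> F} := in_qpoly h.
have pF : p%:R = 0 :> F by rewrite -(rmorph_nat (q \o polyC)) Fp_p rmorph0.
have qE g : (map_poly (e F pF) g).[q 'X] = q (map_poly (e _ Fp_p) g).
  elim/poly_ind: g => [|g c IHg]; first by rewrite !rmorph0 horner0.
  rewrite !rmorphD !rmorphM /= !map_polyX !map_polyC hornerD hornerMX hornerC IHg.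
  by congr (_ + _); apply: esym (rmorph_nat (q \o polyC) (val c)).
have qh : in_qpoly h h = 0.
  by apply/val_inj; rewrite /= (mk_monicE hI) Pdiv.RingMonic.rmodpp.
exists F, pF, (q 'X); split.
- by rewrite card_qfpoly card_Fp // h_sz.
- by rewrite rootE qE; apply/eqP/qh.
- move=> y; have [g def_y] := zp_emb_Fp_surj (val (y : {poly %/ h})).
  by exists g; rewrite qE def_y; apply/esym/in_qpoly_val.
move=> g g_sz; rewrite qE => /(congr1 (fun x : {poly %/ h} => val x)) /=.
rewrite (mk_monicE hI) Pdiv.Ring.rmodp_small; first exact: zp_emb_Fp_ker.
by rewrite h_sz ltnS (leq_trans (size_poly _ _)).
Qed.

Local Notation x0 := (in_qpoly f 'X : R).

Lemma galois_monic : f \is monic. Proof. by case: f_galois. Qed.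

Lemma galois_s_gt0 : (0 < s)%N.
Proof.
case: f_galois => f_mon f_sz [+ _]; rewrite -/(map_poly (e _ Fp_p) f).
by rewrite size_map_poly_id0 ?f_sz // (monicP f_mon) rmorph1 oner_eq0.
Qed.

Lemma galois_size_gt1 : (1 < size f)%N.
Proof. by case: f_galois => _ -> _; rewrite ltnS galois_s_gt0. Qed.

Lemma galois_ring_n : n%:R = 0 :> R.
Proof.
have -> : n%:R = qpolyC f n%:R :> {poly %/ f} by rewrite rmorph_nat.
by rewrite pchar_Zp ?pt_gt1 // rmorph0.
Qed.

Lemma galois_ring_pt : p%:R ^+ t = 0 :> R.
Proof. by rewrite -natrX galois_ring_n. Qed.

Lemma card_galois_ring : #|{: R}| = ((p ^ s) ^ t)%N.
Proof.
have -> : #|{: R}| = #|{poly %/ f}| by [].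
rewrite card_monic_qpoly ?galois_size_gt1 ?galois_monic // card_ord.
have [_ -> _] := f_galois; have := Zp_cast pt_gt1 => /= ->.
by rewrite -!expnM mulnC.
Qed.

(** * The residue map and the lift of Frobenius *)

Section Residue.
Variables (F : finFieldType) (pF : p%:R = 0 :> F) (w : F).
Hypothesis cardF : #|F| = (p ^ s)%N.
Hypothesis fw : root (map_poly (e F pF) f) w.
Hypothesis w_gen : forall y, exists g, y = (map_poly (e F pF) g).[w].
Hypothesis w_ker : forall g : {poly 'Z_n}, (size g <= s)%N ->
  (map_poly (e F pF) g).[w] = 0 -> exists k, g = p%:R * k.

Local Notation eF := (e F pF).
Local Notation eR := (zp_emb pt_gt1 galois_ring_n).

Definition residue : {rmorphism R -> F} := qeval_morph galois_monic galois_size_gt1 fw.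

Lemma residue_in_qpoly g : residue (in_qpoly f g) = (map_poly eF g).[w].
Proof. exact: (qeval_in_qpoly galois_monic galois_size_gt1). Qed.

Lemma residue_surj y : exists x, residue x = y.
Proof. by have [g ->] := w_gen y; exists (in_qpoly f g); apply: residue_in_qpoly. Qed.

Lemma residue_ker x : residue x = 0 -> exists y, x = p%:R * y.
Proof.
move=> x_0; have [|k def_x] := w_ker _ x_0.
  have szm : size (mk_monic f) = s.+1.
    by rewrite (mk_monic_id galois_monic galois_size_gt1); case: f_galois.
  by rewrite -ltnS -szm size_mk_monic.
exists (in_qpoly f k : R); rewrite -[LHS](in_qpoly_val (x : {poly %/ f})) def_x.
by rewrite rmorphM rmorph_nat.
Qed.

Lemma Frobenius_eval g : (map_poly eF g).[w] ^+ p = (map_poly eF g).[w ^+ p].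
Proof.
have pchF : p \in [pchar F] by rewrite inE p_pr pF eqxx.
exact: (horner_zp_emb _ _ (pFrobenius_aut pchF)).
Qed.

(** Since ['X^(p ^ s) - 'X] vanishes on [F], it equals a multiple [d * f] plus a multiple of [p].
    Differentiating at [w] gives [-1 = d(w) * f'(w)], so [w] is a simple root. *)
Lemma deriv_root_neq0 : (map_poly eF f)^`().[w] != 0.
Proof.
pose g : {poly 'Z_n} := 'X^(p ^ s) - 'X.
have /residue_ker[r def_g] : residue (in_qpoly f g) = 0.
  rewrite residue_in_qpoly rmorphB /= map_polyXn map_polyX !hornerE.
  by rewrite -cardF expf_card subrr.
have /(congr1 (fun h => (map_poly eF h)^`().[w])) :=
  Pdiv.RingMonic.rdivp_eq galois_monic g.
have -> : Pdiv.Ring.rmodp g f = p%:R * val (r : {poly %/ f}).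
  have val_Mn m (x : {poly %/ f}) : val (x *+ m) = val x *+ m.
    by elim: m => // m IHm; rewrite !mulrS -IHm.
  rewrite -{1}(mk_monic_id galois_monic galois_size_gt1) mulr_natl -val_Mn.
  by rewrite -[LHS]/(val (in_qpoly f g)) (def_g : in_qpoly f g = _) mulr_natl.
rewrite rmorphB rmorphD !rmorphM /= map_polyXn map_polyX rmorph_nat.
have -> : p%:R = 0 :> {poly F} by rewrite -polyC_natr pF.
rewrite mul0r addr0 derivB derivXn derivX derivM !hornerE (rootP fw) mulr0 add0r.
rewrite hornerMn -mulr_natl natrX pF expr0n eqn0Ngt galois_s_gt0 mul0r sub0r.
by move=> E; apply: contra_eq_neq E => ->; rewrite mulr0 oppr_eq0 oner_eq0.
Qed.

(** Newton iteration started at the [p]-th power of the class of ['X]; its residue [w ^+ p] is again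
    a root because Frobenius fixes the coefficients of [f] in [F]. *)
Lemma hensel_lift k : exists y : R,
  residue y = w ^+ p /\ exists z, (map_poly eR f).[y] = p%:R ^+ k.+1 * z.
Proof.
elim: k => [|k [y [res_y [z fy]]]].
  exists (x0 ^+ p); have res_y : residue (x0 ^+ p) = w ^+ p.
    by rewrite rmorphXn residue_in_qpoly map_polyX hornerX.
  split=> //; apply: residue_ker.
  rewrite (horner_zp_emb _ _ _ (pt_eq0 pF)) res_y -Frobenius_eval.
  by rewrite (rootP fw) expr0n eqn0Ngt prime_gt0.
have [|u f'u] := residue_unit galois_ring_pt residue_surj residue_ker
                   (u := (map_poly eR f)^`().[y]).
  rewrite deriv_map (horner_zp_emb _ _ _ (pt_eq0 pF)) res_y -Frobenius_eval.
  by rewrite expf_neq0 // -deriv_map deriv_root_neq0.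
have [c fyh] := horner_addr (map_poly eR f) y (- (p%:R ^+ k.+1 * z * u)).
exists (y - p%:R ^+ k.+1 * z * u); split.
  by rewrite rmorphB !rmorphM rmorphXn rmorph_nat pF expr0n !mul0r subr0.
(* The linear term cancels the error exactly, leaving the quadratic term with [2k + 2] factors of
   [p], of which [k + 2] are split off. *)
exists (p%:R ^+ k * z ^+ 2 * u ^+ 2 * c); rewrite fyh fy.
have -> : (map_poly eR f)^`().[y] * - (p%:R ^+ k.+1 * z * u) =
  - (p%:R ^+ k.+1 * z * ((map_poly eR f)^`().[y] * u)) by ring.
by rewrite f'u !exprS; ring.
Qed.

Lemma Frobenius_lift_exists :
  exists phi : {rmorphism R -> R}, forall x, residue (phi x) = residue x ^+ p.
Proof.
(* After [t] steps the error is a multiple of [p ^ t.+1], hence zero, and [y] is an exact root. *)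
have [y [res_y [z]]] := hensel_lift t; rewrite exprS galois_ring_pt mulr0 mul0r => fy.
have rfy : root (map_poly eR f) y by apply/eqP.
exists (qeval_morph galois_monic galois_size_gt1 rfy) => x.
rewrite [LHS](horner_zp_emb _ _ _ (pt_eq0 pF)) res_y -Frobenius_eval.
by [].
Qed.

End Residue.

End GaloisRing.

(** * Formal duality over the Galois ring *)

Theorem theorem3p13 (p t s : nat) (f : {poly 'Z_(p ^ t)})
    (C : numClosedFieldType) (zeta : C)
    (S : {set galois_ring f * galois_ring f}) :
  prime p -> (0 < t)%N -> galois_poly s f ->
  (p ^ t)%N.-primitive_root zeta ->
  grds_layer_ideal p t s S ->
  (forall T : {set galois_ring f * galois_ring f},
     primitive_formally_dual (gr_char s zeta) S T <->
     grds_ideal_layer p t s T) /\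
  primitive_formally_dual (gr_char s zeta) S [set xy | (xy.2, xy.1) \in S].
Proof.
move=> p_pr t_gt0 f_gal zeta_prim grdsS.
have [F [pF [w [cardF fw w_gen w_ker]]]] := residue_field_exists p_pr t_gt0 f_gal.
have [phi phiP] := Frobenius_lift_exists f_gal cardF fw w_gen w_ker.
have pi_surj := residue_surj f_gal fw w_gen.
have pi_ker := @residue_ker _ _ _ _ _ _ f_gal _ _ _ fw w_ker.
have cardR := card_galois_ring p_pr t_gt0 f_gal.
have pt0 := galois_ring_pt f p_pr t_gt0.
pose R : finComNzRingType := galois_ring f.
pose lam (x : R) := (val (x : {poly %/ f}))`_0.
pose psi (x : R) : C := zeta ^+ val (lam (trace p t s x)).
have zeta_val m : zeta ^+ val (m%:R : 'Z_(p ^ t)) = zeta ^+ m.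
  by rewrite /= val_Zp_nat ?pt_gt1 // prim_expr_mod.
have lam_nat m : lam m%:R = m%:R.
  by rewrite /lam /= qpolyC_natr -polyC_natr coefC.
have trD := traceD cardF pt0 pi_surj pi_ker (erefl _) phiP.
(* Both the trace and its constant coefficient are additive; reduction of the exponent modulo
   [p ^ t] is absorbed by [zeta]. *)
have psiD x y : psi (x + y) = psi x * psi y.
  have lamD u v : lam (u + v) = lam u + lam v by apply: coefD.
  rewrite /psi trD lamD -[lam (trace p t s x)]natr_Zp -[lam (trace p t s y)]natr_Zp.
  by rewrite -natrD !zeta_val exprD.
have psi0 : psi 0 = 1.
  have tr0 : trace p t s (0 : R) = 0.
    by apply: (addrI (trace p t s 0)); rewrite -trD !addr0.
  by rewrite /psi tr0 (lam_nat 0%N) expr0.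
have psi_norm x : `|psi x| = 1.
  apply/eqP; rewrite -(@pexpr_eq1 _ _ (p ^ t)) ?expn_gt0 ?prime_gt0 //.
  by rewrite -normrX /psi exprAC (prim_expr_order zeta_prim) expr1n normr1.
have psiN x : psi (- x) = (psi x)^*.
  apply: (mulfI (_ : psi x != 0)); first by rewrite -normr_eq0 psi_norm oner_eq0.
  by rewrite -psiD subrr psi0 -normCK psi_norm expr1n.
(* The exponent is [p ^ t.-1 * c] with [c] prime to [p], so the order [p ^ t] of [zeta] does not
   divide it. *)
have psi_prim : exists z, psi (p%:R ^+ t.-1 * z) != 1.
  have [z [c [p_c tr_z]]] :=
    trace_primitive t_gt0 cardF pt0 pi_surj pi_ker p_pr (erefl _) phiP.
  exists z; rewrite /psi tr_z lam_nat zeta_val -(prim_order_dvd zeta_prim).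
  by rewrite -{1}(prednK t_gt0) expnSr dvdn_pmul2l // expn_gt0 prime_gt0.
have layerE (a b : R) :
    (if (vp p t a <= vp p t b)%N then (p ^ (vp p t a * s))%N else 0%N) =
    layer_count p t (p ^ s) a b.
  by rewrite /layer_count mulnC expnM.
have nuS (a b : R) : nu S (a, b) = layer_count p t (p ^ s) a b.
  by rewrite grdsS layerE.
have iffT T : primitive_formally_dual (gr_char s zeta) S T <-> grds_ideal_layer p t s T.
  have [fwd bwd] := grds_dual_iff t_gt0 cardF cardR pt0 pi_surj pi_ker
                      psi0 psiD psiN psi_prim T nuS.
  split=> [/fwd nuT a b|grdsT]; first by rewrite nuT -layerE.
  by apply: bwd => a b; rewrite grdsT layerE.
split=> //; apply/iffT => a b.
by rewrite nu_swap grdsS.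
Qed.
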